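(* Let $n,s,t$ be integers with $s>t\ge1$ and $5(s+t)\le n\le\frac{(s+t)^2}{3t}$. If $\mathcal F\subset\binom{[n]}{3}$ has property $U(s,2s+t)$, i.e. $|F_1\cup\ldots\cup F_s|\le 2s+t$ for all $F_1,\ldots,F_s\in\mathcal F$, then $|\mathcal F|\le|\mathcal A(s+t,2,n,3)|$.
   Context: $\mathcal A(p,r,n,k):=\{A\in\binom{[n]}{k}:|A\cap[p]|\ge r\}$, where $\binom{[n]}{k}$ is the set of $k$-subsets of $[n]=\{1,\ldots,n\}$. The sets $F_i$ need not be distinct. *)

(* Defs.v *)
From mathcomp Require Import all_boot.

Set Implicit Arguments.
Unset Strict Implicit.
Unset Printing Implicit Defensive.

(* The ground set [n] = {1, ..., n} is encoded as 'I_n = {0, ..., n-1};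
   the element i of [n] corresponds to the ordinal of value i - 1. *)

Definition ksubsets (n k : nat) : {set {set 'I_n}} :=
  [set A : {set 'I_n} | #|A| == k].

(* [p] seen inside [n]; this is all of [n] when p >= n. *)
Definition initial_seg (n p : nat) : {set 'I_n} := [set i : 'I_n | i < p].

Definition calA (p r n k : nat) : {set {set 'I_n}} :=
  [set A in ksubsets n k | r <= #|A :&: initial_seg n p|].

(* The members F 0, ..., F (s-1) are not required to be distinct. *)
Definition propertyU (n s q : nat) (FF : {set {set 'I_n}}) : Prop :=
  forall F : 'I_s -> {set 'I_n},
    (forall i, F i \in FF) -> #|\bigcup_(i < s) F i| <= q.

(* Main.v *)
Require Import Defs.
From mathcomp Require Import all_boot zify.

Set Implicit Arguments.
Unset Strict Implicit.
Unset Printing Implicit Defensive.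

(* Put p = s + t and q = 2 s + t, and number the points from 0.  Shifting
   preserves U(s, q), so the family F may be taken shifted.  Let D be the graph
   on [0, q) of the pairs e with e + {q} in F; by shiftedness such an e can be
   completed by any other point of [0, q].  Members of F that together cover
   [0, q] must number more than s, and this forces one of two situations.
   - D has no t + 1 disjoint edges.  Then the same holds for the link of every
     z >= q, a graph on z vertices with matching number at most t has at most
     t z edges, and |F| <= C(q, 3) + t * sum_(q <= z < n) z, which is small
     enough because of the two bounds on n.
   - D has t + 1 disjoint edges.  Then D has b = p - a vertices for some a >= 0,
     which are covered by s - a - 1 edges of D.  The remaining a + 1 members of F
     cannot contain a + 1 disjoint pairs outside these b vertices, which bounds
     the number of members meeting the b vertices in at most one point; this is
     outweighed by the loss of C(p, 2) - C(b, 2) pairs. *)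

(** * Shifting *)

Section Shifting.
Variable n : nat.
Implicit Types (F G : {set 'I_n}) (FF : {set {set 'I_n}}).

Definition shifted FF :=
  forall F (i j : 'I_n), F \in FF -> j \in F -> i \notin F -> i < j ->
  i |: F :\ j \in FF.

Definition shift_set (i j : 'I_n) FF F :=
  if [&& j \in F, i \notin F & i |: F :\ j \notin FF] then i |: F :\ j else F.

Definition shift_family (i j : 'I_n) FF := shift_set i j FF @: FF.

Definition weight FF := \sum_(F in FF) \sum_(x in F) x.

Lemma swap_inv (i j : 'I_n) F :
  j \in F -> i \notin F -> j |: (i |: F :\ j) :\ i = F.
Proof.
move=> jF iF; apply/setP=> x; rewrite !inE.
case: (eqVneq x j) => [->|] //=.
by case: (eqVneq x i) => [->|] //=; rewrite (negPf iF).
Qed.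

(** Two moved sets with equal images coincide by undoing the swap. A moved set cannot collide with a
    fixed one, since a set moves only when its image lies outside [FF]. *)
Lemma shift_set_inj (i j : 'I_n) FF : {in FF &, injective (shift_set i j FF)}.
Proof.
move=> F G FF1 GF1; rewrite /shift_set.
case: ifP => [/and3P[jF iF nF]|_]; case: ifP => [/and3P[jG iG nG]|_] //.
- by move=> e; rewrite -(swap_inv jF iF) e swap_inv.
- by move=> e; rewrite e GF1 in nF.
- by move=> e; rewrite -e FF1 in nG.
Qed.

Lemma card_shift_family i j FF : #|shift_family i j FF| = #|FF|.
Proof. exact: card_in_imset (@shift_set_inj i j FF). Qed.

Lemma card_swap (i j : 'I_n) F : j \in F -> i \notin F -> #|i |: F :\ j| = #|F|.
Proof.
move=> jF iF; rewrite cardsU1 !inE (negPf iF) andbF /=.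
by rewrite [in RHS](cardsD1 j) jF.
Qed.

Lemma shift_family_ksubsets i j k FF :
  FF \subset ksubsets n k -> shift_family i j FF \subset ksubsets n k.
Proof.
move=> /subsetP sF; apply/subsetP=> _ /imsetP[F FF1 ->]; move: (sF _ FF1).
by rewrite /shift_set !inE; case: ifP => // /and3P[jF iF _]; rewrite card_swap.
Qed.

(** This is how members are pulled back to [FF]. A set stays put only when the swap does not apply
    or its result is already in [FF]; a set that moved is sent back to its origin by the reverse
    swap. *)
Lemma shift_family_mem i j FF F : F \in shift_family i j FF ->
  (F \in FF /\ (j \in F -> i \notin F -> i |: F :\ j \in FF))
  \/ [/\ i \in F, j \notin F & j |: F :\ i \in FF].
Proof.
case/imsetP=> G GF ->; rewrite /shift_set; case: ifP => [/and3P[jG iG nG]|h].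
  case: (eqVneq i j) => [e|ne]; first by rewrite e jG in iG.
  right; rewrite swap_inv // !inE !eqxx (negPf ne) eq_sym; split=> //.
  by rewrite (negPf ne).
by left; split=> // jG iG; move: h; rewrite jG iG /= => /negbFE.
Qed.

Lemma bigcupD1_sub (s : nat) (A B : 'I_s -> {set 'I_n}) (x : 'I_n) :
  (forall l, A l :\ x \subset B l) ->
  (\bigcup_l A l) :\ x \subset \bigcup_l B l.
Proof.
move=> h; apply/subsetP=> y; rewrite !inE => /andP[yx /bigcupP[l _ yl]].
by apply/bigcupP; exists l => //; apply: (subsetP (h l)); rewrite !inE yx.
Qed.

(** Members of the shifted family are replaced by members of [FF] whose union is at least as large.
    [B] undoes every move, which can lose only the point i. *)
Lemma shift_family_propertyU (i j : 'I_n) s q FF :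
  propertyU s q FF -> propertyU s q (shift_family i j FF).
Proof.
move=> hU A hA; have [eij|nij] := eqVneq i j.
  apply: hU => l; have := hA l; case/imsetP=> G GF ->; rewrite /shift_set eij.
  by case: (j \in G).
have hA' l := shift_family_mem (hA l).
pose B l := if A l \in FF then A l else j |: A l :\ i.
have BF l : B l \in FF.
  by rewrite /B; case: ifP => // h; case: (hA' l) => [[]|[]] //; rewrite h.
have [/forallP allF|/forallPn[l0 l0n]] := boolP [forall l, A l \in FF].
  exact: hU.
have [il0 jl0 sl0] : [/\ i \in A l0, j \notin A l0 & j |: A l0 :\ i \in FF].
  by case: (hA' l0) => // -[h]; rewrite h in l0n.
have AB l : A l :\ i \subset B l.
  rewrite /B; case: ifP => _; first exact: subD1set.
  exact: subsetUr.
set U := \bigcup_l A l.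
have jB0 : j \in B l0 by rewrite /B (negPf l0n) !inE eqxx.
have jB : j \in \bigcup_l B l by apply/bigcupP; exists l0.
have UB : U :\ i \subset \bigcup_l B l by apply: bigcupD1_sub.
(* If j is not in [U], the union of [B] gains j and so makes up for the possible loss of i. *)
have [jU|jU] := boolP (j \in U); last first.
  apply: leq_trans (hU B BF).
  have : j |: U :\ i \subset \bigcup_l B l by rewrite subUset sub1set jB.
  move/subset_leq_card; apply: leq_trans; rewrite cardsU1 !inE (negPf jU) andbF.
  by rewrite (cardsD1 i U) leq_add2r leq_b1.
(* A set containing j has not moved, so [A l1] is in [FF]. If it contains i, nothing is lost.
   Otherwise its own swap is in [FF] and supplies i in [C], while [B l0] still supplies j. *)
have /bigcupP[l1 _ jl1] := jU.
have l1F : A l1 \in FF by case: (hA' l1) => [[]|[_ h]] //; rewrite jl1 in h.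
have [il1|il1] := boolP (i \in A l1).
  apply: leq_trans (hU B BF); apply: subset_leq_card.
  have iB : i \in \bigcup_l B l by apply/bigcupP; exists l1; rewrite // /B l1F.
  by rewrite -(setD1K (_ : i \in U)) ?subUset ?sub1set ?iB //; apply/bigcupP; exists l0.
have sl1 : i |: A l1 :\ j \in FF.
  by case: (hA' l1) => [[_ h]|[h]]; [apply: h | rewrite h in il1].
pose C l := if l == l1 then i |: A l1 :\ j else B l.
have CF l : C l \in FF by rewrite /C; case: ifP.
apply: leq_trans (hU C CF); apply: subset_leq_card; apply/subsetP=> x.
case: (eqVneq x i) => [-> _|xi].
  by apply/bigcupP; exists l1; rewrite // /C eqxx !inE eqxx.
case: (eqVneq x j) => [-> _|xj].
  apply/bigcupP; exists l0; rewrite // /C ifN //.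
  by apply: contraNneq jl0 => ->.
case/bigcupP=> l _ xl; apply/bigcupP; exists l => //; rewrite /C.
case: eqP => [<-|_]; first by rewrite !inE xj xl orbT.
by apply: (subsetP (AB l)); rewrite !inE xi.
Qed.

Lemma sum_swap (i j : 'I_n) F : j \in F -> i \notin F ->
  \sum_(x in i |: F :\ j) x + j = \sum_(x in F) x + i.
Proof.
move=> jF iF; rewrite big_setU1 ?inE ?(negPf iF) ?andbF //=.
by rewrite (big_setD1 j jF) /= addnC [RHS]addnC addnCA.
Qed.

Lemma weight_shift_family (i j : 'I_n) FF F :
  F \in FF -> j \in F -> i \notin F -> i < j -> i |: F :\ j \notin FF ->
  weight (shift_family i j FF) < weight FF.
Proof.
move=> FF1 jF iF ij nF; rewrite /weight big_imset /=; last exact: shift_set_inj.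
have le G : \sum_(x in shift_set i j FF G) x <= \sum_(x in G) x.
  rewrite /shift_set; case: ifP => // /and3P[jG iG _].
  by have := sum_swap jG iG; lia.
rewrite (bigD1 F) //= [ltnRHS](bigD1 F) //= -addSn leq_add //; last first.
  by apply: leq_sum.
by rewrite /shift_set jF iF nF /= -(ltn_add2r j) (sum_swap jF iF) ltn_add2l.
Qed.

(** Induction on [weight]: a shift that changes the family replaces larger points by smaller ones,
    and a family that no such shift changes is shifted. *)
Lemma exists_shifted k s q FF :
  FF \subset ksubsets n k -> propertyU s q FF ->
  exists GG, [/\ shifted GG, GG \subset ksubsets n k, propertyU s q GG
               & #|GG| = #|FF|].
Proof.
have [m] := ubnP (weight FF); elim: m FF => // m IH FF lem hk hU.
pose bad (u : {set 'I_n} * ('I_n * 'I_n)) := let: (F, (i, j)) := u in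
  [&& F \in FF, j \in F, i \notin F, i < j & i |: F :\ j \notin FF].
have [[F [i j]]|] := pickP bad.
  rewrite /bad => /and5P[FF1 jF iF ij nF].
  have [||GG [h1 h2 h3 h4]] := IH (shift_family i j FF) _ _ (shift_family_propertyU (i := i) (j := j) hU).
  - by apply: leq_trans (weight_shift_family FF1 jF iF ij nF) _.
  - exact: shift_family_ksubsets.
  - by exists GG; split=> //; rewrite h4 card_shift_family.
move=> nb; exists FF; split=> // F i j FF1 jF iF ij.
by have /= := nb (F, (i, j)); rewrite FF1 jF iF ij /= => /negbFE.
Qed.
End Shifting.

(** * Numerical estimates *)

(** Here and for [bin3_mul6], denominators are cleared and negative terms moved across, so that the
    estimates become polynomial inequalities over the naturals. *)
Lemma bin2_mul2 m : 2 * 'C(m, 2) + m = m * m.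
Proof.
rewrite mul2n bin2; case: m => // m.
by have := odd_double_half (m.+1 * m.+1.-1); rewrite oddM /=; case: (odd m) => /=; nia.
Qed.

Lemma bin3_mul6 m : 6 * 'C(m, 3) + 3 * (m * m) = m * m * m + 2 * m.
Proof.
have := mul_bin_left m 2; have := bin2_mul2 m.
by case: m => [|[|m]] //; rewrite subn2 /=; nia.
Qed.

Lemma sum_nat_range (n q : nat) : q <= n ->
  2 * (\sum_(q <= z < n) z) + n + q * q = n * n + q.
Proof.
elim: n => [|n IH]; first by rewrite leqn0 => /eqP ->; rewrite big_nil.
rewrite leq_eqVlt => /orP[/eqP<-|h]; first by rewrite big_geq //; lia.
by rewrite big_nat_recr //=; have := IH h; nia.
Qed.

(** In the application b is the number of vertices of D, a = s + t - b, w = q - b, h counts the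
    pairs outside these vertices that extend to members, and f counts the members disjoint from
    them. *)
Lemma many_disjoint_pairs_count (a b n w h f : nat) :
  1 <= b -> 5 * (a + b) <= n -> w <= 2 * a + b -> h <= a * w -> 3 * f <= h * w ->
  'C(b, 3) + 'C(b, 2) * (n - b) + b * h + f
    <= 'C(a + b, 3) + 'C(a + b, 2) * (n - (a + b)).
Proof.
move=> b1 hn hw hh hf.
have e1 := bin3_mul6 b; have e2 := bin2_mul2 b.
have e3 := bin3_mul6 (a + b); have e4 := bin2_mul2 (a + b).
have [m hm] : exists m, n = m + 5 * (a + b) by exists (n - 5 * (a + b)); lia.
have -> : n - b = m + 5 * a + 4 * b by lia.
have -> : n - (a + b) = m + 4 * (a + b) by lia.
have h1 : h <= a * (2 * a + b) by apply: leq_trans hh _; rewrite leq_mul.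
have h2 : 3 * f <= a * (2 * a + b) * (2 * a + b) by apply: leq_trans hf _; rewrite leq_mul.
have h3 : b * h <= b * (a * (2 * a + b)) by rewrite leq_mul2l h1 orbT.
set B := 'C(b, 2) in e2 *; set P := 'C(a + b, 2) in e4 *.
have h4 : B * m <= P * m by rewrite leq_mul2r leq_bin2l ?orbT // leq_addl.
(* With h and f replaced by their bounds and n = 5 (a + b), six times the right side minus the left
   side of the goal is exactly the difference of these two sides. The excess m of n is covered by
   [h4]. *)
have h5 : a * (15 * (a + b)) <= a * (5 * (a * a) + 19 * (a * b) + 16 * (b * b) + 2).
  by clear -b1; rewrite leq_mul2l; apply/orP; case: a => [|a]; [left | right; nia].
clear hh hf hw hn hm.
move: (b * h) h3 => bh h3.
rewrite !mulnDr; move: (B * m) (P * m) h4 => Bm Pm h4.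
(* The formulas for [B] and [P] are multiplied by the factors of the goal, which leaves a problem
   linear in the monomials. *)
have e2a : 2 * (B * (5 * a)) + b * (5 * a) = b * b * (5 * a) by rewrite -e2; lia.
have e2b : 2 * (B * (4 * b)) + b * (4 * b) = b * b * (4 * b) by rewrite -e2; lia.
have e4a : 2 * (P * (4 * a)) + (a + b) * (4 * a) = (a + b) * (a + b) * (4 * a) by rewrite -e4; lia.
have e4b : 2 * (P * (4 * b)) + (a + b) * (4 * b) = (a + b) * (a + b) * (4 * b) by rewrite -e4; lia.
lia.
Qed.

(** Put p = s + t and q = 2 s + t, so q <= 2 p. Six times the left side is at most about 8 p^3 + 3 t
    n^2, and 3 t n^2 <= p^2 n by the upper bound on n. Six times the right side is about p^3 + 3 p^2
    (n - p). To leading order 10 p^3 <= 2 p^2 n remains, which is the lower bound on n. *)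
Lemma few_disjoint_pairs_count (n s t : nat) :
  1 <= t -> t < s -> 5 * (s + t) <= n -> n * (3 * t) <= (s + t) ^ 2 ->
  'C(2 * s + t, 3) + t * (\sum_(2 * s + t <= z < n) z)
    <= 'C(s + t, 3) + 'C(s + t, 2) * (n - (s + t)).
Proof.
move=> t1 ts hn; rewrite -mulnn => hu.
have e1 := bin3_mul6 (2 * s + t).
have e3 := bin3_mul6 (s + t); have e4 := bin2_mul2 (s + t).
have e5 : 2 * (\sum_(2 * s + t <= z < n) z) + n + (2 * s + t) * (2 * s + t) = n * n + (2 * s + t).
  by apply: sum_nat_range; lia.
move: (\sum_(_ <= _ < _) _) e5 => S e5.
(* Both bounds on n give 5 (s + t) * 3 t <= (s + t)^2, and one factor s + t cancels. *)
have p15 : 15 * t <= s + t.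
  by clear -t1 hn hu; rewrite -(@leq_pmul2r (s + t)) ?addn_gt0 ?t1 ?orbT //; nia.
have [m hm] : exists m, n = m + 5 * (s + t) by exists (n - 5 * (s + t)); lia.
have -> : n - (s + t) = m + 4 * (s + t) by lia.
have hu1 : 3 * t * (n * n) <= (s + t) * (s + t) * n.
  by rewrite mulnA leq_mul2r mulnC hu orbT.
have e5' : 6 * (t * S) + 3 * t * n + 3 * t * ((2 * s + t) * (2 * s + t)) = 3 * t * (n * n) + 3 * t * (2 * s + t).
  by have := congr1 (muln (3 * t)) e5; lia.
set P := 'C(s + t, 2) in e4 *.
have e4a : 6 * (P * (m + 4 * (s + t))) + 3 * (s + t) * (m + 4 * (s + t)) = 3 * ((s + t) * (s + t)) * (m + 4 * (s + t)).
  by have -> : 3 * ((s + t) * (s + t)) = 3 * (2 * P + (s + t)); [rewrite e4 | lia].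
have [r hr] : exists r, s = r + 14 * t by exists (s - 14 * t); lia.
move: (t * S) (P * _) e5' e4a => tS PP e5' e4a.
rewrite hm in hu1 e5'.
suff : 6 * 'C(2 * s + t, 3) + 6 * tS <= 6 * 'C(s + t, 3) + 6 * PP by lia.
clear hu e5 hn hm.
subst s.
have hm2 : 3 * (r + 14 * t + t) * m <= 2 * ((r + 14 * t + t) * (r + 14 * t + t)) * m.
  by clear -t1; rewrite leq_mul2r; apply/orP; right; nia.
have hp : (r + 14 * t + t) * (r + 14 * t + t) <= t * ((r + 14 * t + t) * (r + 14 * t + t)).
  by rewrite leq_pmull.
lia.
Qed.

(** * Matchings and links *)

Section FinSets.
Variable T : finType.
Implicit Types (A B V : {set T}) (H MM : {set {set T}}).

Lemma exists_subset_card A k : k <= #|A| -> exists2 B : {set T}, B \subset A & #|B| = k.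
Proof.
case/card_geqP=> r [ur <- sr]; exists [set x in r].
  by apply/subsetP=> x; rewrite inE => /sr.
by rewrite cardsE; apply/card_uniqP.
Qed.

Lemma exists_between_card A B k : A \subset B -> #|A| <= k <= #|B| ->
  exists C : {set T}, [/\ A \subset C, C \subset B & #|C| = k].
Proof.
move=> sAB /andP[Ak kB].
have [|C sC cC] := @exists_subset_card (B :\: A) (k - #|A|).
  by rewrite cardsDS // leq_sub2r.
exists (A :|: C); rewrite subsetUl subUset sAB (subset_trans sC (subsetDl _ _)).
split=> //; rewrite cardsU cC.
suff -> : A :&: C = set0 by rewrite cards0; lia.
by apply/eqP; rewrite setI_eq0 disjoint_sym; move: sC; rewrite subsetD => /andP[].
Qed.

Lemma leq_card_bigcup (I : finType) (P : pred I) (F : I -> {set T}) :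
  #|\bigcup_(i | P i) F i| <= \sum_(i | P i) #|F i|.
Proof.
elim/big_rec2: _ => [|i m A _ le]; first by rewrite cards0.
by apply: leq_trans (leq_card_setU _ _).1 _; rewrite leq_add2l.
Qed.

Lemma card_cover_pairs MM : {in MM, forall e : {set T}, #|e| = 2} -> trivIset MM ->
  #|cover MM| = 2 * #|MM|.
Proof.
move=> h /eqP <-; rewrite (eq_bigr (fun=> 2)) => [|e /h //].
by rewrite sum_nat_const mulnC.
Qed.

(* Colouring the pair {x, y} by (rank x + rank y) mod |V| splits the complete
   graph on V into |V| matchings. *)
Lemma card_pairs_matching V H a :
  {in H, forall e : {set T}, e \subset V /\ #|e| = 2} ->
  (forall MM, MM \subset H -> trivIset MM -> #|MM| <= a) ->
  #|H| <= a * #|V|.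
Proof.
move=> hH hM; pose idx x := index x (enum V).
case: (posnP #|V|) => [V0|Vpos].
  suff -> : H = set0 by rewrite cards0.
  apply/setP=> e; rewrite inE; apply/negP=> /hH[/subset_leq_card].
  by rewrite V0 leqn0 => /eqP ->.
have idxV x : x \in V -> idx x < #|V|.
  by move=> xV; rewrite cardE index_mem mem_enum.
pose col (e : {set T}) : 'I_#|V| := Ordinal (ltn_pmod (\sum_(x in e) idx x) Vpos).
rewrite -sum1_card (partition_big col predT) //= mulnC.
rewrite -[X in X * a]card_ord -sum_nat_const; apply: leq_sum => c _.
rewrite sum1dep_card; apply: hM; first by apply/subsetP=> e; rewrite inE => /andP[].
apply/trivIsetP=> A B; rewrite !inE => /andP[AH /eqP cA] /andP[BH /eqP cB].
(* Two edges of one colour that share x have other endpoints of congruent rank; ranks are below |V|,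
   so the edges agree. *)
apply: contraR; rewrite -setI_eq0 => /set0Pn[x]; rewrite inE => /andP[xA xB].
have [sA nA] := hH _ AH; have [sB nB] := hH _ BH.
have : #|A :\ x| == 1 by move: nA; rewrite (cardsD1 x) xA; lia.
have : #|B :\ x| == 1 by move: nB; rewrite (cardsD1 x) xB; lia.
case/cards1P=> z eB /cards1P[y eA].
have yA : y \in A by have := set11 y; rewrite -eA inE => /andP[].
have zB : z \in B by have := set11 z; rewrite -eB inE => /andP[].
have yV := subsetP sA _ yA; have zV := subsetP sB _ zB.
have := congr1 val (etrans cA (esym cB)) => /=.
rewrite (big_setD1 x xA) (big_setD1 x xB) /= eA eB !big_set1 => /eqP.
rewrite eqn_modDl !modn_small ?idxV // => /eqP eyz.
suff eq : y = z by rewrite -(setD1K xA) -(setD1K xB) eA eB eq.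
rewrite -(nth_index x (_ : y \in enum V)) ?mem_enum //.
rewrite -[RHS](nth_index x (_ : z \in enum V)) ?mem_enum //.
by congr nth.
Qed.

End FinSets.

(** * Links of points in a shifted family *)

Section Links.
Variable n : nat.
Implicit Types (z : 'I_n) (F G e : {set 'I_n}) (FF MM : {set {set 'I_n}}).

Lemma card_initial_seg k : k <= n -> #|initial_seg n k| = k.
Proof.
move=> kn; rewrite -[RHS]card_ord /initial_seg -sum1dep_card -sum1_card.
by rewrite [RHS](big_ord_widen n (fun=> 1) kn).
Qed.

(** Only pairs below z are kept, so the links sort the triples by their largest point. The graph D
    is [link FF q]. *)
Definition link FF (z : 'I_n) : {set {set 'I_n}} :=
  [set e : {set 'I_n} | [&& #|e| == 2, e \subset initial_seg n z & z |: e \in FF]].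

Lemma linkP FF z e : reflect
  [/\ #|e| = 2, e \subset initial_seg n z & z |: e \in FF] (e \in link FF z).
Proof. by rewrite inE; apply: (iffP and3P) => -[/eqP]. Qed.

Lemma link_notin FF z e : e \in link FF z -> z \notin e.
Proof.
by case/linkP=> _ /subsetP h _; apply/negP=> /h; rewrite inE ltnn.
Qed.

Lemma link_extend FF z e (x : 'I_n) : shifted FF ->
  e \in link FF z -> x <= z -> x \notin e -> x |: e \in FF.
Proof.
move=> sh he xz xe; have ze := link_notin he.
have [_ _ zF] := linkP _ _ _ he.
move: xz; rewrite leq_eqVlt => /orP[/eqP/val_inj->//|xz].
have := sh _ x z zF; rewrite !inE eqxx /= (negPf xe) orbF setU1K //.
by apply=> //; apply/negP=> /eqP h; rewrite h ltnn in xz.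
Qed.

Lemma propertyU_seq s q FF (S : seq {set 'I_n}) : propertyU s q FF ->
  {subset S <= FF} -> size S <= s -> #|\bigcup_(F in S) F| <= q.
Proof.
move=> hU sS; case eS: S => [|F0 S'] sz.
  rewrite (_ : \bigcup_(F in [::]) F = set0) ?cards0 //.
  by rewrite -bigcup_seq big_nil.
rewrite -eS in sz *.
(* Repetitions are allowed, so a short list is padded to length s with its first member [F0]. *)
have h (i : 'I_s) : nth F0 S i \in FF.
  case: (ltnP i (size S)) => hi; first by apply: sS; rewrite mem_nth.
  by rewrite nth_default //; apply: sS; rewrite eS mem_head.
apply: leq_trans (hU _ h); apply: subset_leq_card; apply/bigcupsP=> F FS.
have lti : index F S < s by apply: leq_trans sz; rewrite index_mem.
by apply: (bigcup_max (Ordinal lti)); rewrite //= nth_index.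
Qed.

(* Each of the pairs in E can be completed by an arbitrary point of [0, q],
   so that the sets obtained exhaust the q + 1 points of [0, q]. *)
Lemma spanning_absurd s (q : 'I_n) FF (E S : seq {set 'I_n}) :
  shifted FF -> propertyU s q FF ->
  {subset E <= link FF q} -> {subset S <= FF} -> size E + size S <= s ->
  #|initial_seg n q.+1 :\: (\bigcup_(e in E) e :|: \bigcup_(F in S) F)|
     <= size E -> False.
Proof.
move=> sh hU sE sS sz; set R := _ :\: _ => hR.
(* The i-th edge takes the i-th uncovered point. If the uncovered points run out, the default q
   still completes the edge to a member, by the definition of [link]. *)
pose W := [seq nth q (enum R) i |: nth set0 E i | i <- iota 0 (size E)] ++ S.
have sW : {subset W <= FF}.
  move=> F; rewrite mem_cat => /orP[/mapP[i]|/sS//].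
  rewrite mem_iota /= add0n => iE ->.
  have eE := mem_nth set0 iE; have eD := sE _ eE.
  case: (ltnP i (size (enum R))) => hi; last first.
    by rewrite nth_default //; case/linkP: eD.
  have := mem_nth q hi; rewrite mem_enum !inE negb_or -andbA ltnS.
  case/and3P=> [h1 _ h2]; apply: (link_extend sh eD h2).
  by apply: contra h1 => h; apply/bigcupP; exists (nth set0 E i).
have := propertyU_seq hU sW; rewrite size_cat size_map size_iota => /(_ sz).
apply/negP; rewrite -ltnNge -[leqLHS](@card_initial_seg q.+1) ?ltn_ord //.
apply: subset_leq_card; apply/subsetP=> x xq.
have [xR|] := boolP (x \in R); last first.
  rewrite !inE negb_and negbK -orbA => /or3P[||]; last first.
  - by move: xq; rewrite inE => ->.
  - case/bigcupP=> F FS xF; apply/bigcupP; exists F => //.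
    by rewrite mem_cat FS orbT.
  - case/bigcupP=> e eE xe; apply/bigcupP.
    exists (nth q (enum R) (index e E) |: e); last by rewrite !inE xe orbT.
    rewrite mem_cat; apply/orP; left; apply/mapP; exists (index e E).
      by rewrite mem_iota /= add0n index_mem.
    by rewrite nth_index.
have xeR : x \in enum R by rewrite mem_enum.
apply/bigcupP; exists (x |: nth set0 E (index x (enum R))); last by rewrite !inE eqxx.
rewrite mem_cat; apply/orP; left; apply/mapP; exists (index x (enum R)).
  by rewrite mem_iota /= add0n; apply: leq_trans hR; rewrite cardE index_mem.
by rewrite nth_index.
Qed.

(** The matching covers two points of [C] per edge, and every other point of [C] receives one edge
    of its own, so each matching edge saves one. *)
Lemma exists_edge_cover (D MM : {set {set 'I_n}}) (C : {set 'I_n}) :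
  {in D, forall e : {set 'I_n}, #|e| = 2} -> MM \subset D -> trivIset MM ->
  cover MM \subset C -> C \subset cover D ->
  exists E : seq {set 'I_n},
    [/\ {subset E <= D}, size E + #|MM| = #|C| & C \subset \bigcup_(e in E) e].
Proof.
move=> D2 sM tM sMC sCD.
pose ed v := odflt set0 [pick e in D | v \in e].
have edP v : v \in C -> ed v \in D /\ v \in ed v.
  move/(subsetP sCD)/bigcupP=> [e eD ve]; rewrite /ed.
  by case: pickP => [e' /andP[]//|/(_ e)]; rewrite eD ve.
exists (enum MM ++ [seq ed v | v <- enum (C :\: cover MM)]); split.
- move=> e; rewrite mem_cat mem_enum => /orP[/(subsetP sM)//|/mapP[v]].
  by rewrite mem_enum inE => /andP[_ /edP[h _]] ->.
- have cM : #|cover MM| = 2 * #|MM|.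
    by apply: card_cover_pairs => // e /(subsetP sM)/D2.
  rewrite size_cat size_map -!cardE cardsDS // addnAC addnn -mul2n -cM subnKC //.
  exact: subset_leq_card.
apply/subsetP=> v vC; have [/bigcupP[e eM ve]|nv] := boolP (v \in cover MM).
  by apply/bigcupP; exists e; rewrite // mem_cat mem_enum eM.
apply/bigcupP; exists (ed v); last by case: (edP v vC).
by rewrite mem_cat map_f ?orbT // mem_enum inE nv.
Qed.

(** Induction on the number of points of [G] that are at least q: they are shifted below q until one
    is left, which is then shifted to q, and v is kept throughout. *)
Lemma link_cover_mem FF (q : 'I_n) G (v : 'I_n) :
  shifted FF -> FF \subset ksubsets n 3 -> 3 < q ->
  G \in FF -> v \in G -> v < q -> ~~ (G \subset initial_seg n q) ->
  v \in cover (link FF q).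
Proof.
move=> sh h3 q3; have [m] := ubnP #|G :\: initial_seg n q|.
elim: m G => // m IH G lem GF vG vq nG.
have G3 : #|G| = 3 by have := subsetP h3 _ GF; rewrite inE => /eqP.
have /subsetPn[z zG] := nG; rewrite inE -leqNgt => qz.
have [sub|/subsetPn[y]] := boolP (G :\ z \subset initial_seg n q).
  apply/bigcupP; exists (G :\ z); last first.
    by rewrite !inE vG andbT; apply: contraTneq vq => ->; rewrite -leqNgt.
  apply/linkP; split=> //; first by move: G3; rewrite (cardsD1 z) zG; lia.
  move: qz; rewrite leq_eqVlt => /orP[/eqP/val_inj->|qz]; first by rewrite setD1K.
  apply: sh => //; apply/negP=> qG; have := subsetP sub q.
  rewrite !inE qG ltnn andbT => h; have := h _; case: eqP => // e; last by move=> /(_ isT).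
  by rewrite e ltnn in qz.
rewrite !inE -leqNgt => /andP[yz yG] qy.
(* As q > 3, the triple misses a point below q. It replaces y, while z keeps the new triple outside
   [0, q). *)
have [w wq wG] : exists2 w : 'I_n, w < q & w \notin G.
  have : ~~ (initial_seg n q \subset G).
    apply/negP=> /subset_leq_card; rewrite card_initial_seg ?G3; last first.
      by rewrite ltnW ?ltn_ord.
    by rewrite leqNgt q3.
  by case/subsetPn=> w; rewrite inE => wq wG; exists w.
have vy : v != y by apply: contraTneq vq => ->; rewrite -leqNgt.
have wz : z != w by apply: contraTneq wq => <-; rewrite -leqNgt.
apply: (IH (w |: G :\ y)) => //.
- rewrite -ltnS; apply: leq_trans lem; apply: proper_card; apply/properP; split.
    apply/subsetP=> x; rewrite !inE; case: eqP => [->|_] /=; first by rewrite wq.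
    by case/and3P=> -> _ ->.
  exists y; first by rewrite !inE yG andbT -leqNgt.
  rewrite !inE eqxx /= orbF; apply/negP=> /andP[_ /eqP h].
  by rewrite h (negPf wG) in yG.
- by apply: sh => //; apply: leq_trans wq qy.
- by rewrite !inE vy vG orbT.
- apply/subsetPn; exists z; last by rewrite inE -leqNgt.
  by rewrite !inE (eq_sym z y) yz zG orbT.
Qed.

(** By [link_cover_mem] every point of [F] below q is in the cover. If there were at most one, two
    points y, z would be at least q; replacing y by an arbitrary v < q would then put all of [0, q)
    into the cover. *)
Lemma card_cap_link_cover FF (q : 'I_n) F :
  shifted FF -> FF \subset ksubsets n 3 -> 3 < q ->
  #|cover (link FF q)| < q ->
  F \in FF -> ~~ (F \subset initial_seg n q) -> 1 < #|F :&: cover (link FF q)|.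
Proof.
move=> sh h3 q3 ltq FF1 nF; rewrite ltnNge; apply/negP=> le1.
have F3 : #|F| = 3 by have := subsetP h3 _ FF1; rewrite inE => /eqP.
have : #|F :&: initial_seg n q| <= 1.
  apply: leq_trans le1; apply: subset_leq_card; apply/subsetP=> v.
  rewrite inE => /andP[vF]; rewrite !inE => vq; rewrite vF.
  exact: link_cover_mem FF1 vF vq nF.
have := cardsID (initial_seg n q) F; rewrite F3 => e le.
have : 1 < #|F :\: initial_seg n q| by lia.
case/card_gt1P=> y [z []]; rewrite !inE -!leqNgt => /andP[qy yF] /andP[qz zF] yz.
have : q <= #|cover (link FF q)|; last by rewrite leqNgt ltq.
rewrite -[leqLHS](@card_initial_seg q); last by rewrite ltnW ?ltn_ord.
apply: subset_leq_card; apply/subsetP=> v; rewrite inE => vq.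
have [vF|vF] := boolP (v \in F); first exact: link_cover_mem FF1 vF vq nF.
apply: (@link_cover_mem FF q (v |: F :\ y)) => //.
- by apply: sh => //; apply: leq_trans vq qy.
- by rewrite !inE eqxx.
- apply/subsetPn; exists z; last by rewrite inE -leqNgt.
  by rewrite !inE zF andbT (eq_sym z y) yz orbT.
Qed.

Lemma link_matching_down FF (q z : 'I_n) MM :
  shifted FF -> q <= z -> MM \subset link FF z -> trivIset MM ->
  2 * #|MM| <= q ->
  exists MM' : {set {set 'I_n}}, [/\ MM' \subset link FF q, trivIset MM' & #|MM'| = #|MM|].
Proof.
move=> sh qz; have [m] := ubnP #|cover MM :\: initial_seg n q|.
elim: m MM => // m IH MM lem sM tM leM.
have M2 : {in MM, forall e : {set 'I_n}, #|e| = 2}.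
  by move=> e /(subsetP sM)/linkP[].
have cM := card_cover_pairs M2 tM.
have [sub|/subsetPn[y]] := boolP (cover MM \subset initial_seg n q).
  exists MM; split=> //; apply/subsetP=> e eM.
  have eq : e \subset initial_seg n q.
    by apply: subset_trans sub; apply: bigcup_max eM _.
  have ez := subsetP sM _ eM; apply/linkP; split=> //; first exact: M2.
  by apply: (link_extend sh ez qz); apply/negP=> /(subsetP eq); rewrite inE ltnn.
move=> yM; rewrite inE -leqNgt => qy; have /bigcupP[e eM ye] := yM.
(* The matching has at most q vertices and one of them is y >= q, so some point below q is free. *)
have [v vq vM] : exists2 v : 'I_n, v < q & v \notin cover MM.
  have : ~~ (y |: initial_seg n q \subset cover MM).
    apply/negP=> /subset_leq_card; rewrite cM cardsU1 card_initial_seg.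
      by rewrite inE ltnNge qy /= add1n ltnNge leM.
    by rewrite ltnW ?ltn_ord.
  case/subsetPn=> v; rewrite !inE => /orP[/eqP->|vq vM]; first by rewrite yM.
  by exists v.
have nv B : B \in MM -> v \notin B.
  by move=> BM; apply: contra vM => vB; apply/bigcupP; exists B.
pose e' := v |: e :\ y.
have [e2 sez zeF] := linkP _ _ _ (subsetP sM _ eM).
have ze := link_notin (subsetP sM _ eM).
have e'z : e' \in link FF z.
  apply/linkP; split; first by rewrite card_swap ?nv.
    rewrite subUset sub1set inE (leq_trans vq qz).
    by apply: subset_trans sez; rewrite subD1set.
  rewrite setUCA.
  have yz : y != z by apply: contraNneq ze => <-.
  have -> : z |: e :\ y = (z |: e) :\ y.
    by rewrite setDUl; congr (_ :|: _); apply/setP=> x; rewrite !inE;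
       case: eqP => [->|]; rewrite ?andbF // eq_sym yz.
  apply: sh => //; rewrite ?inE ?ye ?orbT //; last by apply: leq_trans vq qy.
  by rewrite negb_or nv // andbT; apply: contraTneq vq => ->; rewrite -leqNgt.
have dis : {in MM :\ e, forall B : {set 'I_n}, [disjoint e' & B]}.
  move=> B; rewrite !inE => /andP[Be BM].
  rewrite -setI_eq0; apply/eqP/setP=> x; rewrite !inE; apply/negP.
  case/andP=> /orP[/eqP->|/andP[_ xe]] xB; first by rewrite (negPf (nv _ BM)) in xB.
  have /trivIsetP/(_ _ _ BM eM Be) := tM.
  by rewrite -setI_eq0 => /eqP/setP/(_ x); rewrite !inE xB xe.
have [||tM' nM'] := trivIsetU1 dis; first exact: trivIsetS (subD1set _ _) tM.
  by rewrite !inE negb_and; apply/orP; right; apply/negP=> /M2; rewrite cards0.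
have cM' : #|e' |: MM :\ e| = #|MM| by rewrite cardsU1 nM' [RHS](cardsD1 e) eM.
have [||//||M' [h1 h2 h3]] := IH (e' |: MM :\ e); last by exists M'; rewrite h3.
- rewrite -ltnS; apply: leq_trans lem; apply: proper_card; apply/properP; split.
    apply/subsetP=> x; rewrite !inE => /andP[xq /bigcupP[B]].
    rewrite (negPf xq) /= !inE => /orP[/eqP->|/andP[_ BM]] xB; last first.
      by apply/bigcupP; exists B.
    move: xB; rewrite !inE => /orP[/eqP h|/andP[_ xe]].
      by rewrite h vq in xq.
    by apply/bigcupP; exists e.
  exists y; first by rewrite !inE yM andbT -leqNgt.
  rewrite !inE negb_and; apply/orP; right; apply/negP=> /bigcupP[B].
  rewrite !inE => /orP[/eqP->|/andP[Be BM]] yB.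
    by move: yB; rewrite !inE eqxx orbF => /eqP h; move: vq; rewrite -h ltnNge qy.
  have /trivIsetP/(_ _ _ BM eM Be) := tM.
  by rewrite -setI_eq0 => /eqP/setP/(_ y); rewrite !inE yB ye.
- rewrite subUset sub1set e'z; apply: subset_trans sM; exact: subD1set.
- by rewrite cM'.
Qed.

End Links.

(** * Counting *)

Section Counting.
Variable n : nat.
Implicit Types (F e : {set 'I_n}) (FF MM : {set {set 'I_n}}).

(** Besides the triples inside [P] there are those with exactly two points in [P], parametrised by a
    pair e in [P] and a point z outside; both are recovered by cutting the triple with [P] and its
    complement. *)
Lemma calA2_lower_bound p : p <= n ->
  'C(p, 3) + 'C(p, 2) * (n - p) <= #|calA p 2 n 3|.
Proof.
rewrite /calA => /card_initial_seg; move: (initial_seg n p) => P cP.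
pose f (u : {set 'I_n} * 'I_n) := u.2 |: u.1.
pose X := setX [set e : {set 'I_n} | e \subset P & #|e| == 2] (~: P).
have fI u : u \in X -> f u :&: P = u.1 /\ f u :\: P = [set u.2].
  case: u => e z; rewrite !inE /f /= => /andP[/andP[eP _] zP].
  split; apply/setP=> x; rewrite !inE.
    case: eqP => [->|_] /=; last first.
      by case xe: (x \in e); rewrite //= (subsetP eP).
    by rewrite (negPf zP); apply/esym/negP=> /(subsetP eP); rewrite (negPf zP).
  case: eqP => [->|_] /=; first by rewrite zP.
  by case xe: (x \in e); rewrite ?andbF // (subsetP eP).
have injf : {in X &, injective f}.
  move=> u v uX vX e; have [h1 h2] := fI u uX; have [h3 h4] := fI v vX.
  rewrite e h3 in h1; rewrite e h4 in h2; move: h1 => /esym.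
  by case: u v {uX vX e h3 h4} h2 => [a b] [c d] /= /set1_inj -> ->.
have cX : #|f @: X| = 'C(p, 2) * (n - p).
  rewrite card_in_imset // cardsX cards_draws cP; congr (_ * _).
  by rewrite -[n in RHS]card_ord -(cardsC P) cP addKn.
pose A3 := [set F : {set 'I_n} | F \subset P & #|F| == 3].
rewrite -cX -{1}cP -(cards_draws P 3) -/A3.
have /eqP <- : #|A3 :|: f @: X| == #|A3| + #|f @: X|.
  rewrite (leq_card_setU _ _).2 -setI_eq0; apply/eqP/setP=> F; rewrite !inE; apply/negP.
  case/andP=> /andP[FP _] /imsetP[u uX eF].
  have [_ /setP/(_ u.2)] := fI u uX; rewrite -eF !inE eqxx => /andP[h].
  by move/(subsetP FP); rewrite (negPf h).
apply: subset_leq_card; apply/subsetP=> F; rewrite !inE => /orP[/andP[FP F3]|/imsetP[u uX eF]].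
  by rewrite F3 /= (setIidPl FP) (eqP F3).
have [h1 h2] := fI u uX; have := cardsID P F.
move: uX; rewrite !inE => /andP[/andP[_ /eqP c2] _].
by rewrite eF h1 h2 cards1 c2 => <-.
Qed.

Lemma many_disjoint_pairs_bound FF s t (q : 'I_n) MM :
  1 <= t -> t < s -> 5 * (s + t) <= n -> q = 2 * s + t :> nat ->
  shifted FF -> FF \subset ksubsets n 3 -> propertyU s q FF ->
  MM \subset link FF q -> trivIset MM -> #|MM| = t.+1 ->
  #|FF| <= 'C(s + t, 3) + 'C(s + t, 2) * (n - (s + t)).
Proof.
move=> t1 ts hn hq sh h3 hU sM tM cM.
set D := link FF q; set N := cover D; set b := #|N|.
have D2 : {in D, forall e : {set 'I_n}, #|e| = 2} by move=> e /linkP[].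
have M2 : #|cover MM| = 2 * t.+1.
  by rewrite -cM card_cover_pairs // => e /(subsetP sM)/D2.
have sMN : cover MM \subset N.
  by apply/bigcupsP=> e eM; apply: bigcup_max (subsetP sM _ eM) _.
have bt : 2 * t.+1 <= b by rewrite -M2 subset_leq_card.
have NQ : N \subset initial_seg n q by apply/bigcupsP=> e /linkP[].
have cQ1 : #|initial_seg n q.+1| = q.+1 by rewrite card_initial_seg ?ltn_ord.
have cQ : #|initial_seg n q| = q by rewrite card_initial_seg // ltnW ?ltn_ord.
have NQ1 : N \subset initial_seg n q.+1.
  by apply: subset_trans NQ _; apply/subsetP=> x; rewrite !inE => /ltnW.
(* Otherwise s + t + 1 vertices of D that include the matching are covered by s edges, and s points
   of [0, q] remain, one for each edge. *)
have bp : b <= s + t.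
  rewrite leqNgt; apply/negP=> hb.
  have [|C [sMC sCN cC]] := @exists_between_card _ _ _ (s + t).+1 sMN.
    by rewrite M2 -/b hb andbT; clear -ts; lia.
  have [E [sE zE cE]] := exists_edge_cover D2 sM tM sMC sCN.
  have zEs : size E = s by move: zE; rewrite cM cC; clear; lia.
  apply: (spanning_absurd (S := [::]) sh hU sE) => //.
    by rewrite zEs addn0.
  apply: leq_trans (_ : #|initial_seg n q.+1 :\: C| <= _).
    apply: subset_leq_card; apply: setDS; apply: subset_trans cE (subsetUl _ _).
  rewrite cardsDS ?(subset_trans sCN NQ1) // cQ1 cC zEs hq.
  by clear; lia.
pose a := s + t - b; pose Z := initial_seg n q :\: N.
have cZ : #|Z| = q - b by rewrite cardsDS // cQ.
pose H := [set e : {set 'I_n} |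
  [&& #|e| == 2, e \subset Z & [exists x, x |: e \in FF]]].
have [E [sE zE cE]] := exists_edge_cover D2 sM tM sMN (subxx _).
have zEb : size E = b - t.+1 by move: zE; rewrite cM -/b => <-; rewrite addnK.
(* Given a + 1 disjoint pairs in [H], members containing them and the b - t - 1 edges of [E] are s
   sets in all. They leave at most q + 1 - b - 2 (a + 1) = b - t - 1 points of [0, q], one for each
   edge of [E]. *)
have Hm (M' : {set {set 'I_n}}) : M' \subset H -> trivIset M' -> #|M'| <= a.
  move=> sH' tH'; rewrite leqNgt; apply/negP=> /exists_subset_card[M'' sM'' cM''].
  have sH : M'' \subset H := subset_trans sM'' sH'.
  have tH := trivIsetS sM'' tH'.
  have cM2 : #|cover M''| = 2 * a.+1.
    by rewrite -cM'' card_cover_pairs // => e /(subsetP sH); rewrite inE => /and3P[/eqP].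
  have sMZ : cover M'' \subset Z.
    by apply/bigcupsP=> e /(subsetP sH); rewrite inE => /and3P[].
  pose g (e : {set 'I_n}) : {set 'I_n} := odflt set0 [pick F in FF | e \subset F].
  have gP e : e \in M'' -> g e \in FF /\ e \subset g e.
    move/(subsetP sH); rewrite inE => /and3P[_ _ /existsP[x xF]]; rewrite /g.
    by case: pickP => [F /andP[]//|/(_ (x |: e))]; rewrite xF subsetUr.
  apply: (spanning_absurd (S := [seq g e | e <- enum M'']) sh hU sE).
  - by move=> F /mapP[e]; rewrite mem_enum => /gP[h _] ->.
  - by rewrite size_map -cardE cM'' zEb; rewrite /a; move: bt bp; clear; lia.
  apply: leq_trans (_ : #|(initial_seg n q.+1 :\: N) :\: cover M''| <= _).
    apply: subset_leq_card; rewrite setDDl; apply: setDS; apply: setUSS => //.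
    apply/bigcupsP=> e eM; have [_ eg] := gP e eM; apply: subset_trans eg _.
    by apply: (bigcup_max (g e)) => //; rewrite map_f ?mem_enum.
  have sMQ : cover M'' \subset initial_seg n q.+1 :\: N.
    apply: subset_trans sMZ _; apply: setSD; apply/subsetP=> x.
    by rewrite !inE => /ltnW.
  rewrite (cardsDS sMQ) (cardsDS NQ1) cQ1 cM2 zEb -/b hq.
  by rewrite /a; move: bt bp; clear; lia.
have cH : #|H| <= a * (q - b).
  rewrite -cZ; apply: card_pairs_matching => // e.
  by rewrite inE => /and3P[/eqP h1 h2 _].
have F3 F : F \in FF -> #|F| = 3 by move/(subsetP h3); rewrite inE => /eqP.
pose FF0 := [set F in FF | F \subset Z].
(* Double counting: a member F inside [Z] with a marked point x is determined by the pair F minus x,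
   which lies in [H], and x in [Z]. *)
have cF0 : 3 * #|FF0| <= #|H| * (q - b).
  pose Y := [set u : {set 'I_n} * 'I_n | (u.1 \in FF0) && (u.2 \in u.1)].
  have cY : #|Y| = 3 * #|FF0|.
    rewrite -sum1_card (eq_bigl (fun u => (u.1 \in FF0) && (u.2 \in u.1))); last first.
      by move=> u; rewrite inE.
    rewrite -(pair_big_dep (mem FF0) (fun F x => x \in F) (fun _ _ => 1)) /=.
    rewrite (eq_bigr (fun=> 3)); first by rewrite sum_nat_const mulnC.
    by move=> F; rewrite inE sum1_card => /andP[/F3].
  rewrite -cY -cZ -cardsX.
  pose f (u : {set 'I_n} * 'I_n) := (u.1 :\ u.2, u.2).
  rewrite -(@card_in_imset _ _ f); last first.
    move=> [F x] [G y]; rewrite !inE /f /= => /andP[_ xF] /andP[_ yG] [e ey].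
    by rewrite ey in xF e *; rewrite -(setD1K xF) -(setD1K yG) e.
  apply: subset_leq_card; apply/subsetP=> _ /imsetP[[F x] FY ->].
  move: FY; rewrite !inE /= -andbA => /and3P[FF1 FZ xF].
  have c2 : #|F :\ x| == 2 by have := F3 F FF1; rewrite (cardsD1 x) xF add1n => -[->].
  rewrite c2 (subset_trans (subD1set _ _) FZ) /=.
  have := subsetP FZ x xF; rewrite !inE => ->; rewrite andbT.
  by apply/existsP; exists x; rewrite setD1K.
pose f (u : {set 'I_n} * 'I_n) := u.2 |: u.1.
pose P3 := [set F : {set 'I_n} | F \subset N & #|F| == 3].
pose P2 := f @: setX [set e : {set 'I_n} | e \subset N & #|e| == 2] (~: N).
pose P1 := f @: setX H N.
have bq : b < q by rewrite hq; move: bp ts; clear; lia.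
have q3 : 3 < q by rewrite hq; move: t1 ts; clear; lia.
(* Members are sorted by their number of points in [N]. Those with at most one lie in [0, q) by
   [card_cap_link_cover], so their part outside [N] lies in [Z]. *)
have sub : FF \subset P3 :|: P2 :|: P1 :|: FF0.
  apply/subsetP=> F FF1; have c3 := F3 F FF1.
  have := cardsID N F; rewrite c3.
  have big := card_cap_link_cover sh h3 q3 bq FF1; rewrite -/D -/N in big.
  have FZ : #|F :&: N| <= 1 -> F :\: N \subset Z.
    move=> le1; apply: setSD; apply/negPn/negP=> /big; by rewrite ltnNge le1.
  case e: #|F :&: N| => [|[|[|[|k]]]] // cD.
  - apply/setUP; right; rewrite inE FF1 /=.
    have e0 : F :&: N = set0 by apply/eqP; rewrite -cards_eq0 e.
    have eF : F :\: N = F by rewrite -[RHS](setID F N) e0 set0U.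
    by rewrite -eF FZ ?e.
  - apply/setUP; left; apply/setUP; right.
    have /cards1P[x ex] : #|F :&: N| == 1 by rewrite e.
    have eF : F = x |: F :\: N by rewrite -ex setID.
    have xN : x \in N by have := set11 x; rewrite -ex inE => /andP[].
    apply/imsetP; exists (F :\: N, x); last by [].
    rewrite !inE xN andbT /=; move: cD; rewrite add1n => -[->] /=.
    rewrite FZ ?e //=; apply/existsP; exists x; by rewrite -eF.
  - apply/setUP; left; apply/setUP; left; apply/setUP; right.
    have /cards1P[x ex] : #|F :\: N| == 1 by move: cD; rewrite !addSn add0n => -[->].
    have xN : x \notin N by have := set11 x; rewrite -ex inE => /andP[].
    apply/imsetP; exists (F :&: N, x); first by rewrite !inE subsetIr e xN.
    by rewrite /f /= -ex setUC setID.
  - apply/setUP; left; apply/setUP; left; apply/setUP; left.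
    rewrite inE c3 eqxx andbT; apply/setIidPl/eqP.
    by rewrite eqEcard subsetIl c3 e.
have c3 : #|P3| = 'C(b, 3) by rewrite cards_draws.
have c2 : #|P2| <= 'C(b, 2) * (n - b).
  apply: leq_trans (leq_imset_card _ _) _; rewrite cardsX cards_draws -/b.
  by rewrite leq_mul2l; apply/orP; right; rewrite -[n in leqRHS]card_ord -(cardsC N) addKn.
have c1 : #|P1| <= b * #|H|.
  by apply: leq_trans (leq_imset_card _ _) _; rewrite cardsX mulnC.
have ab : s + t = a + b by rewrite subnK.
apply: leq_trans (_ : 'C(b, 3) + 'C(b, 2) * (n - b) + b * #|H| + #|FF0| <= _).
  apply: leq_trans (subset_leq_card sub) _.
  apply: leq_trans (leq_card_setU _ _).1 _; rewrite leq_add2r.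
  apply: leq_trans (leq_card_setU _ _).1 _; apply: leq_add c1.
  apply: leq_trans (leq_card_setU _ _).1 _; apply: leq_add c2.
  by rewrite c3.
rewrite ab; apply: (@many_disjoint_pairs_count a b n (q - b)) => //.
- by apply: leq_trans bt; clear; lia.
- by rewrite -ab.
- by rewrite hq; move: ab; clear; lia.
Qed.

Lemma few_disjoint_pairs_bound FF t (q : 'I_n) :
  2 * t.+1 <= q -> shifted FF -> FF \subset ksubsets n 3 ->
  (forall MM, MM \subset link FF q -> trivIset MM -> #|MM| <= t) ->
  #|FF| <= 'C(q, 3) + t * \sum_(q <= z < n) z.
Proof.
move=> tq sh h3 hM.
have F3 F : F \in FF -> #|F| = 3 by move/(subsetP h3); rewrite inE => /eqP.
have cL (z : 'I_n) : q <= z -> #|link FF z| <= t * z.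
  move=> qz; rewrite -[X in _ * X](@card_initial_seg n z); last by rewrite ltnW ?ltn_ord.
  apply: card_pairs_matching => [e /linkP[]//|MM sM tM].
  (* A larger matching is cut to exactly t + 1 edges, so that 2 (t + 1) <= q leaves room to move it
     down to the link of q. *)
  rewrite leqNgt; apply/negP=> /exists_subset_card[M' sM' cM'].
  have sML := subset_trans sM' sM; have tM' := trivIsetS sM' tM.
  have [|M'' [sM2 tM2 cM2]] := link_matching_down sh qz sML tM'; first by rewrite cM'.
  by have := hM _ sM2 tM2; rewrite cM2 cM' ltnn.
pose X z := [set z |: e | e in link FF z].
have sub : FF \subset [set F : {set 'I_n} | F \subset initial_seg n q & #|F| == 3]
    :|: \bigcup_(z : 'I_n | q <= z) X z.
  apply/subsetP=> F FF1; rewrite !inE F3 // eqxx andbT.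
  have [//|/subsetPn[z0 z0F]] /= := boolP (F \subset _).
  rewrite inE -leqNgt => qz0; apply/bigcupP.
  (* A triple that leaves [0, q) is filed under its largest point z, which is at least q; the other
     two points form an edge of the link of z. *)
  case: (@arg_maxnP _ z0 (mem F) (@nat_of_ord n) z0F) => z /= zF mz.
  exists z; first exact: leq_trans qz0 (mz _ z0F).
  apply/imsetP; exists (F :\ z); last by rewrite setD1K.
  apply/linkP; split; last by rewrite setD1K.
    by have := F3 F FF1; rewrite (cardsD1 z) zF add1n => -[].
  apply/subsetP=> x; rewrite !inE => /andP[xz xF].
  by rewrite ltn_neqAle xz; apply: mz.
apply: leq_trans (subset_leq_card sub) _.
apply: leq_trans (leq_card_setU _ _).1 _; rewrite cards_draws.
rewrite card_initial_seg; last by rewrite ltnW ?ltn_ord.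
rewrite leq_add2l; apply: leq_trans (leq_card_bigcup _ _) _.
rewrite big_geq_mkord big_distrr /=; apply: leq_sum => z qz.
exact: leq_trans (leq_imset_card _ _) (cL z qz).
Qed.

End Counting.

Theorem theorem9 (n s t : nat) (FF : {set {set 'I_n}})
    (ht : 1 <= t) (hst : t < s)
    (hn_lower : 5 * (s + t) <= n)
    (hn_upper : n * (3 * t) <= (s + t) ^ 2)
    (hFF : FF \subset ksubsets n 3)
    (hU : propertyU s (2 * s + t) FF) :
  #|FF| <= #|calA (s + t) 2 n 3|.
Proof.
have [GG [sh h3 hUG <-]] := exists_shifted hFF hU.
have pn : s + t <= n by lia.
apply: leq_trans (calA2_lower_bound pn).
have qn : 2 * s + t < n by lia.
pose q := Ordinal qn.
have [/existsP[MM /and3P[sM tM cM]]|none] :=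
  boolP [exists MM : {set {set 'I_n}},
           [&& MM \subset link GG q, trivIset MM & t < #|MM|]].
  have [M' sM' cM'] := exists_subset_card cM.
  apply: (@many_disjoint_pairs_bound _ _ s t q M') => //.
    exact: subset_trans sM' sM.
  exact: trivIsetS sM' tM.
apply: leq_trans (few_disjoint_pairs_count ht hst hn_lower hn_upper).
apply: (@few_disjoint_pairs_bound _ _ t q) => // [|MM sM tM]; first by rewrite /=; lia.
by rewrite leqNgt; apply: contra none => cM; apply/existsP; exists MM; rewrite sM tM.
Qed.
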